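(* For every integer $n>1$ there exists an algebraic $(n-1)$-dimensional continued fraction $\mathrm{CF}(A)$ (for some hyperbolic operator $A\in\mathrm{GL}_n(\mathbb{Z})$) that has a proper cyclic palindromic symmetry.
   Context: Let $n\ge 2$. For one-dimensional subspaces $l_1,\dots,l_n$ of $\mathbb{R}^n$ whose linear span is $\mathbb{R}^n$, the hyperplanes spanned by the $(n-1)$-element subsets of $\{l_1,\dots,l_n\}$ divide $\mathbb{R}^n$ into $2^n$ simplicial cones with apex $\vec 0$. Such a cone is irrational if the linear span of each of its facets contains no integer point except $\vec 0$. For an irrational cone $C$, the Klein polyhedron is $\mathcal{K}(C)=\operatorname{conv}(C\cap\mathbb{Z}^n\setminus\{\vec 0\})$ and its boundary $\partial\mathcal{K}(C)$ is called a sail; the $(n-1)$-dimensional continued fraction $\mathrm{CF}(l_1,\dots,l_n)$ is the union of the sails of all $2^n$ cones. An operator $A\in\mathrm{GL}_n(\mathbb{Z})$ is hyperbolic if all its eigenvalues are real and its characteristic polynomial is irreducible over $\mathbb{Q}$. If $l_1,\dots,l_n$ are the eigenspaces of a hyperbolic $A$, then $\mathrm{CF}(l_1,\dots,l_n)=:\mathrm{CF}(A)$ is called an algebraic continued fraction (all its cones are irrational). A symmetry of $\mathrm{CF}(A)$ is an operator $G\in\mathrm{GL}_n(\mathbb{Z})$ with $G(\mathrm{CF}(A))=\mathrm{CF}(A)$; equivalently, there is a permutation $\sigma_G$ of $\{1,\dots,n\}$ with $G(l_i)=l_{\sigma_G(i)}$ for all $i$. A symmetry is palindromic if $\sigma_G\neq\mathrm{id}$;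 it is cyclic if $\sigma_G$ is a cyclic permutation of $\{1,\dots,n\}$ (an $n$-cycle); a palindromic symmetry is proper if $G$ has a fixed point on some sail of $\mathrm{CF}(A)$. *)

(* Defs.v *)
From HB Require Import structures.
From mathcomp Require Import all_boot all_order all_algebra all_fingroup.
From mathcomp Require Import complex.
From mathcomp Require Import all_classical all_reals all_analysis.

Set Implicit Arguments.
Unset Strict Implicit.
Unset Printing Implicit Defensive.
Import Order.TTheory GRing.Theory Num.Theory.
Import numFieldNormedType.Exports.
Local Open Scope classical_set_scope.
Local Open Scope ring_scope.

(* R^n is 'rV[R]_n and, following mxalgebra, a square matrix A acts on it as   *)
(* the operator x |-> x *m A; eigenvalue and eigenspace use that action too.   *)
(* A linear subspace of R^n is the row space of a square matrix; a family of   *)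
(* lines l_1, ..., l_n is thus l : 'I_n -> 'M[R]_n.                            *)

Definition operator (R : realType) (n : nat) (A : 'M[int]_n) : 'M[R]_n :=
  map_mx intr A.
Arguments operator R {n} A.

Definition integer_points (R : realType) (n : nat) : set 'rV[R]_n :=
  [set map_mx intr z | z in [set: 'rV[int]_n]].

Definition convex_hull (R : realType) (n : nat) (X : set 'rV[R]_n) : set 'rV[R]_n :=
  smallest (@convex_set R 'rV[R]_n) X.

Definition boundary (T : topologicalType) (X : set T) : set T :=
  closure X `\` interior X.

Section ContinuedFraction.
Variables (R : realType) (n : nat) (l : 'I_n -> 'M[R]_n).

Definition hyperplane (i : 'I_n) : 'M[R]_n :=
  (\sum_(j < n | j != i) l j)%MS.

Definition off_hyperplanes : set 'rV[R]_n :=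
  [set x | forall i, ~~ (x <= hyperplane i)%MS].

(* When the l i are lines spanning R^n these are the 2^n closed simplicial     *)
(* cones spanned by one ray from each line.                                    *)
Definition cones : set (set 'rV[R]_n) :=
  [set closure (connected_component off_hyperplanes x) | x in off_hyperplanes].

Definition klein_polyhedron (C : set 'rV[R]_n) : set 'rV[R]_n :=
  convex_hull ((C `&` @integer_points R n) `\ 0).

Definition sail (C : set 'rV[R]_n) : set 'rV[R]_n :=
  boundary (klein_polyhedron C).

Definition CF : set 'rV[R]_n := \bigcup_(C in cones) sail C.

Definition symmetry (G : 'M[int]_n) : Prop :=
  G \in unitmx /\ [set x *m operator R G | x in CF] = CF.

(* s is the permutation sigma_G; it is unique when the l i are distinct.       *)
Definition permutes_lines (G : 'M[int]_n) (s : 'S_n) : Prop :=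
  forall i, (l i *m operator R G :=: l (s i))%MS.

Definition palindromic (G : 'M[int]_n) : Prop :=
  symmetry G /\ exists2 s, permutes_lines G s & s != 1%g.

Definition cyclic_symmetry (G : 'M[int]_n) : Prop :=
  symmetry G /\
  exists2 s, permutes_lines G s & forall i, porbit s i = [set: 'I_n]%SET.

Definition proper_palindromic (G : 'M[int]_n) : Prop :=
  palindromic G /\
  exists2 C, cones C & exists2 x, sail C x & x *m operator R G = x.

End ContinuedFraction.

Definition hyperbolic (R : realType) (n : nat) (A : 'M[int]_n) : Prop :=
  [/\ A \in unitmx,
      forall z : R[i], eigenvalue (map_mx intr A) z -> z \is Num.real
    & irreducible_poly (char_poly (map_mx intr A : 'M[rat]_n))].
Arguments hyperbolic R {n} A.

(* The characteristic polynomial of a hyperbolic operator has n distinct real  *)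
(* roots, so l enumerates all of its eigenspaces.                              *)
Definition eigenlines (R : realType) (n : nat) (A : 'M[int]_n)
    (l : 'I_n -> 'M[R]_n) : Prop :=
  exists lambda : 'I_n -> R, injective lambda /\
    forall i, eigenvalue (operator R A) (lambda i) /\
              (l i :=: eigenspace (operator R A) (lambda i))%MS.

(* Main.v *)
Require Import Defs.
From mathcomp Require Import all_boot all_order all_algebra all_fingroup.
From mathcomp Require Import all_solvable all_field complex.
From mathcomp Require Import all_classical all_reals all_analysis.

Set Implicit Arguments.
Unset Strict Implicit.
Unset Printing Implicit Defensive.
Import Order.TTheory GRing.Theory Num.Theory.
Import numFieldNormedType.Exports.
Local Open Scope ring_scope.

(* Take a prime p = 1 mod 2n and the real cyclic field K of degree n inside    *)
(* Q(zeta_p), with generator sigma of its Galois group.  The Gaussian periods  *)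
(* eta_0, ..., eta_(n-1) form a basis of an order of K that sigma permutes     *)
(* cyclically, so in this basis sigma is a cyclic permutation matrix G fixing  *)
(* (1, ..., 1).  Let theta = N_(Q(zeta)/K)(1 - zeta), which is positive and of *)
(* norm p, and let A be the matrix of multiplication by the cyclotomic unit    *)
(* u = sigma(theta) / theta.  If u had fewer than n conjugates then theta, by  *)
(* positivity, would lie in a proper subfield and p would be a proper power;   *)
(* hence A is hyperbolic, and G permutes its eigenlines cyclically.  The cone  *)
(* containing (1, ..., 1) is preserved, and the line R (1, ..., 1), which is   *)
(* fixed pointwise, meets the Klein polyhedron of this cone and its complement,*)
(* hence the sail.                                                            *)
(*   No Galois theory is needed: sigma is the transport of polynomial          *)
(* relations between the conjugates of zeta, which is legitimate since         *)
(* 1 + X + ... + X^(p-1) is irreducible over Q.                                *)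

(** * Primes congruent to 1 modulo N *)

(** Throughout, an index [j] stands for the conjugate under sigma^j, so being fixed by sigma^n
    becomes being [n]-periodic. Descent to K is [gauss_period_span]: an element of Z[zeta] fixed by
    sigma^n is an integer combination of the periods, with the same coefficients in every embedding.
    Applied to products of the unit with periods, it yields the integer matrix A
    ([cunit_mul_period]). Taking p = 1 mod 2n puts complex conjugation in the group generated by
    sigma^n ([conjC_conjz]), whence reality of the periods and positivity of theta. The unit has n
    distinct conjugates ([cunit_inj]), so A has n eigenlines ([eigenspace_lines]); that these values
    are conjugate over Q ([root_cunit]) makes the characteristic polynomial irreducible
    ([irreducible_conjugates]). On the geometric side, [permutes_lines_symmetry] turns a permutation
    of the eigenlines by an integer matrix into a symmetry of the continued fraction, and
    [sail_meets_line] finds a point of a sail on the fixed line. *)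

Local Notation "''Phi_' n" := (Cyclotomic n)
  (at level 8, n at level 2, format "''Phi_' n").

Lemma norm_prim_root (C : numDomainType) n (z : C) :
  n.-primitive_root z -> `|z| = 1.
Proof.
move=> prz; apply/eqP; rewrite -(@pexpr_eq1 _ _ n) ?(prim_order_gt0 prz) //.
by rewrite -normrX (prim_expr_order prz) normr1.
Qed.

(** Each factor [x - z ^+ k] of the value has modulus at least [x - 1 >= 2], and the factor with
    [k = 1] is present. *)
Lemma Cyclotomic_value_gt1 (N : nat) (x : int) :
  (1 < N)%N -> 3 <= x -> 1 < `|('Phi_N).[x]|.
Proof.
move=> N1 x3; have [z prz] := C_prim_root_exists (ltnW N1).
rewrite -(ltr_int algC) intr_norm -horner_map /= (Cintr_Cyclotomic prz).
rewrite horner_prod normr_prod.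
have fac (k : 'I_N) : 2 <= `|('X - (z ^+ k)%:P).[x%:~R]|.
  rewrite !hornerE; apply: le_trans (lerB_dist _ _).
  rewrite normrX (norm_prim_root prz) expr1n lerBrDr ger0_norm.
    by rewrite -(natrD _ 2 1) -[_%:R]/((3%:Z)%:~R) ler_int.
  by rewrite ler0z (le_trans _ x3).
rewrite (bigD1 (Ordinal N1)) ?coprime1n //=.
apply: (@lt_le_trans _ _ 2); first by rewrite ltr1n.
rewrite -[leLHS]mulr1; apply: ler_pM; rewrite ?ler0n ?ler01 //.
  exact: (fac (Ordinal N1)).
apply: (big_ind (fun t => 1 <= t)) => // [a b a1 b1|i _].
  by rewrite -[1]mulr1 ler_pM ?ler01.
by apply: le_trans (fac i); rewrite ler1n.
Qed.

(* A prime factor p of Phi_N(3N) is coprime to N, so X^N - 1 is separable      *)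
(* mod p and the root 3N of Phi_N has order exactly N in 'F_p.                 *)
Lemma prime_1modn_exists (N : nat) :
  (1 < N)%N -> exists2 p, prime p & (N %| p.-1)%N.
Proof.
move=> N1; have N0 := ltnW N1.
pose x : int := (3 * N)%N; set P := ('Phi_N).[x].
have P1 : (1 < `|P|)%N.
  rewrite -ltz_nat abszE; apply: Cyclotomic_value_gt1 => //.
  by rewrite lez_nat leq_pmulr.
pose p := pdiv `|P|; have pr_p : prime p by apply: pdiv_prime.
have rootP : root (map_poly intr 'Phi_N) (x%:~R : 'F_p).
  apply/eqP; rewrite horner_map /= -/P.
  have /dvdnP[q Eq] : (p %| `|P|)%N by apply: pdiv_dvd.
  rewrite [P]intEsign rmorphM /= Eq -pmulrn natrM.
  by rewrite (pchar_Fp_0 pr_p) !mulr0.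
have prodN : \prod_(d <- divisors N) map_poly intr 'Phi_d = 'X^N - 1 :> {poly 'F_p}.
  by rewrite -rmorph_prod prod_Cyclotomic //= rmorphB /= map_polyXn rmorph1.
have xN : (x%:~R : 'F_p) ^+ N = 1.
  apply/eqP; rewrite -subr_eq0.
  have <- : ('X^N - 1 : {poly 'F_p}).[x%:~R] = x%:~R ^+ N - 1 by rewrite !hornerE.
  rewrite -prodN (big_rem N) ?divisors_id //= hornerM (eqP rootP) mul0r //.
(* This is why [x] is a multiple of [N]: if [p] divided [N], then [x] would vanish mod [p], against
   [x ^ N = 1]. *)
have Np0 : (N%:R : 'F_p) != 0.
  apply/negP => /eqP N0p; have := xN.
  by rewrite /x -pmulrn natrM N0p mulr0 expr0n gtn_eqF.
have [d prd dN] := prim_order_exists N0 xN.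
suff dE : d = N.
  exists p => //; rewrite -dE (prim_order_dvd prd).
  have x0 : (x%:~R : 'F_p) != 0.
    by apply: contra_eq_neq xN => ->; rewrite expr0n gtn_eqF // eq_sym oner_neq0.
  rewrite -(inj_eq (mulfI x0)) mulr1 -exprS prednK ?prime_gt0 //.
  by rewrite -[X in _ ^+ X](card_Fp pr_p) expf_card.
(* If the order [d] were a proper divisor of [N], then [x] would be a root of ['Phi_N] and of some
   ['Phi_e] with [e] dividing [d], a double root of ['X^N - 1]. *)
apply/eqP/negPn/negP => dN'.
have : root (\prod_(e <- divisors d) map_poly intr 'Phi_e) (x%:~R : 'F_p).
  rewrite -rmorph_prod prod_Cyclotomic ?(prim_order_gt0 prd) //= rmorphB /= map_polyXn rmorph1.
  by rewrite /root !hornerE (prim_expr_order prd) subrr.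
rewrite /root horner_prod prodf_seq_eq0 => /hasP[e eD /= roote].
have d0 := prim_order_gt0 prd.
have ed : (e %| d)%N by rewrite dvdn_divisors.
have : separable_poly ('X^N - 1 : {poly 'F_p}) by apply: separable_Xn_sub_1.
rewrite -prodN (big_rem N) ?divisors_id //= (big_rem e) /=; last first.
  rewrite mem_rem_uniq ?divisors_uniq // inE -dvdn_divisors // (dvdn_trans ed) // andbT.
  by apply: contraNneq dN' => eN; rewrite eqn_dvd dN -eN.
rewrite separable_mul => /and3P[_ _]; rewrite coprimepMr => /andP[+ _].
by move/coprimep_root => /(_ _ rootP); rewrite (eqP roote) eqxx.
Qed.

(** * Gaussian periods *)

(** The unit group of ['F_p] is cyclic. The generator is kept as a natural number so that it can
    serve as an exponent of roots of unity, the Galois action becoming a shift of [e] in [g ^ e]. *)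
Lemma primitive_root_modp (p : nat) : prime p ->
  exists g : nat,
    [/\ coprime g p, forall a b, (g ^ a == g ^ b %[mod p])%N = (a == b %[mod p.-1])%N
      & forall x, ~~ (p %| x)%N -> exists2 e, (e < p.-1)%N & (g ^ e = x %[mod p])%N].
Proof.
move=> pr_p; have p1 := prime_gt1 pr_p.
have n0 : (0 < p.-1)%N by rewrite -subn1 subn_gt0.
have unitF (x : 'F_p) : x != 0 -> p.-1.-unity_root x.
  move=> x0; apply/unity_rootP.
  apply: (mulfI x0); rewrite mulr1 -exprS prednK ?prime_gt0 //.
  by rewrite -[X in _ ^+ X](card_Fp pr_p) expf_card.
have /hasP[z _ prz] : has p.-1.-primitive_root [seq x : 'F_p | x <- enum 'F_p & x != 0].
  apply: has_prim_root => //.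
  - by apply/allP => x; rewrite map_id mem_filter => /andP[/unitF].
  - by rewrite map_id filter_uniq // enum_uniq.
  - rewrite map_id -rem_filter ?enum_uniq // size_rem ?mem_enum //.
    by rewrite -cardE card_Fp.
pose g : nat := z; have gE : z = g%:R by rewrite natr_Zp.
have eqF a b : (a == b %[mod p])%N = (a%:R == b%:R :> 'F_p).
  by rewrite -(inj_eq val_inj) /= !val_Fp_nat.
exists g; split=> [|a b|x px].
- rewrite coprime_sym prime_coprime // (dvdn_pcharf (pchar_Fp pr_p)) -gE.
  apply: contra_eq_neq (prim_expr_order prz) => ->.
  by rewrite expr0n gtn_eqF // eq_sym oner_neq0.
  by rewrite eqF !natrX -gE (eq_prim_root_expr prz).
have : (x%:R : 'F_p) != 0 by rewrite -(dvdn_pcharf (pchar_Fp pr_p)).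
move/unitF/unity_rootP/(prim_rootP prz) => [i xi].
by exists i => //; apply/eqP; rewrite eqF natrX -gE xi.
Qed.

Section BigNat.
Variables (R : Type) (idx : R) (op : Monoid.com_law idx).

Lemma big_mul_residues (n m : nat) (f : nat -> R) :
  \big[op/idx]_(i < n * m) f i =
  \big[op/idx]_(j < n) \big[op/idx]_(i < m) f (j + n * i)%N.
Proof.
rewrite exchange_big /=.
elim: m => [|m IHm]; first by rewrite muln0 !big_ord0.
rewrite big_ord_recr /= -IHm mulnSr big_split_ord /=; congr (op _ _).
by apply: eq_bigr => j _; rewrite addnC.
Qed.

(** Serves as the Galois invariance of traces and norms. *)
Lemma big_periodic_shift (M : nat) (f : nat -> R) (k : nat) :
  (forall i, f (i + M)%N = f i) ->
  \big[op/idx]_(i < M) f (i + k)%N = \big[op/idx]_(i < M) f i.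
Proof.
move=> fM; elim: k => [|k <-]; first by apply: eq_bigr => i _; rewrite addn0.
case: M fM => [|M] fM; first by rewrite !big_ord0.
rewrite big_ord_recr [RHS]big_ord_recl /= Monoid.mulmC add0n; congr (op _ _).
  by rewrite -(fM k); congr f; rewrite addnS addnC addnS.
by apply: eq_bigr => i _; rewrite /= /bump addnS.
Qed.

End BigNat.

(** The order of [z] divides the prime [p], and it is not 1 because the sum takes the value [p] at
    1. *)
Lemma root_sum_Xn_prim (C : idomainType) (p : nat) (z : C) :
    prime p -> p%:R != 0 :> C ->
  root (\sum_(i < p) 'X^i) z -> p.-primitive_root z.
Proof.
move=> pr_p p0; rewrite /root horner_sum (eq_bigr (fun i : 'I_p => z ^+ i)) => [zs|i _]; last first.
  by rewrite hornerXn.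
have zp : z ^+ p = 1 by apply/eqP; rewrite -subr_eq0 subrX1 (eqP zs) mulr0.
have [d prd] := prim_order_exists (prime_gt0 pr_p) zp.
move=> /(prime_nt_dvdP pr_p) dp; rewrite -dp //; apply/eqP => d1.
move: zs; have := prim_expr_order prd; rewrite d1 expr1 => ->.
rewrite (eq_bigr (fun=> 1)) => [|i _]; last by rewrite expr1n.
by rewrite sumr_const card_ord (negbTE p0).
Qed.

(* Irreducibility over Q of 1 + X + ... + X^(p-1).                            *)
Lemma sum_expr_prim_root (C : idomainType) (p : nat) (y : C) :
  (1 < p)%N -> p.-primitive_root y -> \sum_(i < p) y ^+ i = 0.
Proof.
move=> p1 pry; have := subrX1 y p; rewrite (prim_expr_order pry) subrr.
move=> /esym/eqP; rewrite mulf_eq0 subr_eq0 => /orP[/eqP y1|/eqP//].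
by have := prim_order_dvd pry 1; rewrite y1 expr1 eqxx dvdn1 gtn_eqF.
Qed.

Lemma size_sum_Xn (F : idomainType) (p : nat) : size (\sum_(i < p) 'X^i : {poly F}) = p.
Proof.
rewrite -[RHS](size_poly_eq (n := p) (E := fun=> 1 : F)) ?oner_eq0 //.
congr (size (polyseq _)); rewrite poly_def.
by apply: eq_bigr => i _; rewrite scale1r.
Qed.

(** Having the root [y] in common, [f] and [Psi] are not coprime over Q, so they also share a root
    in [algC]. There it is a primitive [p]-th root of unity with cyclotomic minimal polynomial, of
    the same degree as [Psi]. *)
Lemma prim_root_dvdp (C : numFieldType) (p : nat) (y : C) (f : {poly rat}) :
  prime p -> p.-primitive_root y -> root (map_poly ratr f) y ->
  \sum_(i < p) 'X^i %| f.
Proof.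
move=> pr_p pry fy; set Psi := (X in X %| _).
have sumX (F : fieldType) : ('X - 1) * (\sum_(i < p) 'X^i) = 'X^p - 1 :> {poly F}.
  by rewrite -subrX1.
have mapPsi (F : numFieldType) : map_poly ratr Psi = \sum_(i < p) 'X^i :> {poly F}.
  by rewrite rmorph_sum /=; apply: eq_bigr => i _; rewrite map_polyXn.
have Psiy : root (map_poly ratr Psi) y.
  rewrite mapPsi /root horner_sum (eq_bigr (fun i : 'I_p => y ^+ i)) => [|i _]; last by rewrite !hornerE.
  by rewrite (sum_expr_prim_root (prime_gt1 pr_p) pry).
have : ~~ coprimep Psi f.
  apply/negP; rewrite -(coprimep_map (@ratr C)) => /coprimep_root/(_ Psiy).
  by rewrite (eqP fy) eqxx.
rewrite /coprimep -(size_map_poly (@ratr algC)) => /closed_rootP[z].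
rewrite gcdp_map root_gcd mapPsi => /andP[Psiz fz].
have prz : p.-primitive_root z.
  by apply: root_sum_Xn_prim; rewrite // pnatr_eq0 -lt0n prime_gt0.
have [q [minE mon_q] dv_q] := minCpolyP z.
have sq : size q = p.
  rewrite -(size_map_poly (@ratr algC)) -minE (minCpoly_cyclotomic prz).
  by rewrite size_cyclotomic totient_prime // prednK ?prime_gt0.
have qPsi : q %= Psi.
  by rewrite -dvdp_size_eqp ?sq ?size_sum_Xn // -dv_q mapPsi.
by rewrite -(eqp_dvdl _ qPsi) -dv_q.
Qed.

Local Notation evalz F x := ((map_poly intr F).[x]).

Section GaussianPeriods.
Variables (C : numFieldType) (p g : nat) (w : C).
Hypotheses (pr_p : prime p) (prw : p.-primitive_root w) (cog : coprime g p).
Hypothesis g_eq : forall a b, (g ^ a == g ^ b %[mod p])%N = (a == b %[mod p.-1])%N.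
Hypothesis g_surj :
  forall x, ~~ (p %| x)%N -> exists2 e, (e < p.-1)%N & (g ^ e = x %[mod p])%N.

Let M := p.-1.

(** The conjugate sigma^e(w), where sigma raises roots of unity to the power [g]. *)
Definition conjz (e : nat) : C := w ^+ (g ^ e).

Lemma conjz_prim e : p.-primitive_root (conjz e).
Proof. by rewrite (prim_root_exp_coprime _ prw) coprimeXl. Qed.

Lemma conjzD e k : conjz e ^+ (g ^ k) = conjz (e + k).
Proof. by rewrite -exprM -expnD. Qed.

Lemma conjz_periodic e : conjz (e + M) = conjz e.
Proof. by apply/eqP; rewrite (eq_prim_root_expr prw) g_eq modnDr. Qed.

Lemma g_exp_mod_gt0 e : (0 < g ^ e %% p)%N.
Proof.
rewrite lt0n; apply/negP => /eqP/eqP g0.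
have : coprime (g ^ e) p by rewrite coprimeXl.
by rewrite coprime_sym prime_coprime // /dvdn g0.
Qed.

Lemma g_exp_mod_inj a b :
  (a < M)%N -> (b < M)%N -> (g ^ a = g ^ b %[mod p])%N -> a = b.
Proof. by move=> aM bM /eqP; rewrite g_eq !modn_small // => /eqP. Qed.

Lemma big_g_exp (R : Type) (idx : R) (op : Monoid.com_law idx) (f : nat -> R) :
  \big[op/idx]_(i < p) f i =
  op (f 0%N) (\big[op/idx]_(e < M) f (g ^ e %% p)%N).
Proof.
have p0 := prime_gt0 pr_p.
have ltM (e : 'I_M) : ((g ^ e %% p).-1 < M)%N.
  by rewrite -ltnS !prednK ?g_exp_mod_gt0 // ltn_mod.
have hinj : injective (fun e => Ordinal (ltM e)).
  move=> a b [/(congr1 S)]; rewrite !prednK ?g_exp_mod_gt0 // => ab.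
  by apply: val_inj; apply: g_exp_mod_inj ab.
rewrite -(big_mkord predT) (big_ltn p0); congr (op _ _).
rewrite big_add1 -/M big_mkord (reindex_inj hinj).
by apply: eq_bigr => e _; rewrite /= prednK ?g_exp_mod_gt0.
Qed.

(** A rational polynomial vanishing at one conjugate is a multiple of 1 + X + ... + X^(p-1), hence
    vanishes at all of them. *)
Lemma root_conjz (f : {poly rat}) a b :
  root (map_poly ratr f) (conjz a) -> root (map_poly ratr f) (conjz b).
Proof.
move=> /(prim_root_dvdp pr_p (conjz_prim a)) /dvdpP[q ->].
rewrite rmorphM rootM /=; apply/orP; right; rewrite rmorph_sum /root horner_sum.
rewrite (eq_bigr (fun i : 'I_p => conjz b ^+ i)) => [|i _]; last first.
  by rewrite /= map_polyXn !hornerE.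
by rewrite (sum_expr_prim_root (prime_gt1 pr_p) (conjz_prim b)).
Qed.

Lemma root_int_conjz (F : {poly int}) a b :
  evalz F (conjz a) = 0 -> evalz F (conjz b) = 0.
Proof.
have FE : map_poly intr F = map_poly ratr (map_poly intr F) :> {poly C}.
  by rewrite -map_poly_comp; apply: eq_map_poly => x; rewrite /= ratr_int.
by rewrite FE => Fa; apply/eqP; apply: (root_conjz (a := a)); apply/eqP.
Qed.

Lemma conjz_free (c : nat -> int) :
  \sum_(e < M) (c e)%:~R * conjz e = 0 -> forall e, (e < M)%N -> c e = 0.
Proof.
move=> c0 e0 e0M.
(* The exponents [g ^ e %% p] are the distinct numbers 1, ..., p-1. Dividing the relation by [w]
   lowers the degree below p-1, so divisibility by 1 + X + ... + X^(p-1) forces [f = 0]. *)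
pose f : {poly rat} := \sum_(e < M) (c e)%:~R *: 'X^((g ^ e %% p).-1).
have fw : root (map_poly ratr f) w.
  rewrite /root -(inj_eq (mulfI (x := w) _)); last first.
    apply: contra_eq_neq (prim_expr_order prw) => ->.
    by rewrite expr0n gtn_eqF ?prime_gt0 // eq_sym oner_neq0.
  apply/eqP; rewrite mulr0 -[RHS]c0 rmorph_sum horner_sum mulr_sumr.
  apply: eq_bigr => e _; rewrite /= map_polyZ map_polyXn rmorph_int hornerZ hornerXn.
  rewrite mulrCA -exprS. by rewrite prednK ?g_exp_mod_gt0 // (prim_expr_mod prw).
have : f`_((g ^ e0 %% p).-1) = (c e0)%:~R.
  rewrite coef_sum (bigD1 (Ordinal e0M)) //= coefZ coefXn eqxx mulr1.
  rewrite big1 ?addr0 // => e ee0; rewrite coefZ coefXn.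
  case: eqP => [eq1|]; last by rewrite mulr0.
  case/eqP: ee0; apply: val_inj; apply: g_exp_mod_inj => //=; apply/esym.
  by rewrite -[LHS]prednK ?g_exp_mod_gt0 // eq1 prednK ?g_exp_mod_gt0.
suff -> : f = 0 by rewrite coef0 => /esym/eqP; rewrite intr_eq0 => /eqP.
apply/eqP/negP => f0; have /negP := f0.
move=> /dvdp_leq/(_ (prim_root_dvdp pr_p prw fw)).
rewrite size_sum_Xn leqNgt => /negP; apply.
rewrite -(prednK (prime_gt0 pr_p)) ltnS.
apply: leq_trans (size_sum _ _ _) _; apply/bigmax_leqP => e _.
apply: leq_trans (size_scale_leq _ _) _; rewrite size_polyXn.
rewrite prednK ?g_exp_mod_gt0 // -ltnS prednK ?prime_gt0 //.
by rewrite ltn_mod prime_gt0.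
Qed.

Lemma sum_conjz k : \sum_(e < M) conjz (e + k) = -1.
Proof.
rewrite (big_periodic_shift _ _ conjz_periodic).
have := sum_expr_prim_root (prime_gt1 pr_p) prw.
rewrite (big_g_exp _ (fun i => w ^+ i)) /= expr0 => /eqP; rewrite addrC addr_eq0 => /eqP <-.
by apply: eq_bigr => e _; rewrite (prim_expr_mod prw).
Qed.

(** Evaluate at 1 the factorisation of (X^p - 1)/(X - 1) into linear factors. *)
Lemma prod_1subconjz : \prod_(e < M) (1 - conjz e) = p%:R.
Proof.
have /eqP := factor_Xn_sub_1 prw.
rewrite (big_ltn (prime_gt0 pr_p)) subrX1 expr0 polyC1.
have X1 : 'X - 1 != 0 :> {poly C} by rewrite -polyC1 polyXsubC_eq0.
rewrite (inj_eq (mulfI X1)) => /eqP/(congr1 (fun q => q.[1])).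
rewrite horner_prod horner_sum => E.
transitivity (\sum_(i < p) ('X^i : {poly C}).[1]); last first.
  rewrite (eq_bigr (fun=> 1)) => [|i _]; last by rewrite !hornerE expr1n.
  by rewrite sumr_const card_ord.
rewrite -E.
(* The value 1 at index 0 neutralises the extra term of [big_g_exp]. *)
have := big_g_exp [the Monoid.com_law _ of *%R] (fun i => if i is 0%N then 1 else 1 - w ^+ i).
rewrite -(big_mkord predT (fun i => if i is 0%N then 1 else 1 - w ^+ i)) (big_ltn (prime_gt0 pr_p)) /= !mul1r => E'.
transitivity (\prod_(1 <= i < p) (1 - w ^+ i)); last first.
  by apply: eq_bigr => i _; rewrite !hornerE.
transitivity (\prod_(1 <= i < p) (if i is 0%N then 1 else 1 - w ^+ i)); last first.
  by apply: eq_big_nat => -[].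
rewrite E'; apply: eq_bigr => e _.
by case: (g ^ e %% p)%N (g_exp_mod_gt0 e) (prim_expr_mod prw (g ^ e)) => // i _ ->.
Qed.

(** A power of a conjugate is again a conjugate, unless the exponent is a multiple of [p]; then it
    is 1, which is minus the sum of all conjugates. The coefficients [c] do not depend on the
    embedding [k]. *)
Lemma conjz_span (F : {poly int}) :
  exists2 c : nat -> int, forall e, c (e + M)%N = c e
    & forall k, evalz F (conjz k) = \sum_(e < M) (c e)%:~R * conjz (e + k).
Proof.
pose c1 (i e : nat) : int := if (p %| i)%N then -1 else (g ^ e == i %[mod p])%N%:R.
have c1P i k : conjz k ^+ i = \sum_(e < M) (c1 i e)%:~R * conjz (e + k).
  rewrite /c1; have [pi|/g_surj[e0 e0M ei]] := boolP (p %| i)%N.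
    rewrite -mulr_sumr sum_conjz rmorphN1 mulrNN mulr1.
    by apply/eqP; rewrite -(prim_order_dvd (conjz_prim k)).
  rewrite (bigD1 (Ordinal e0M)) //= ei eqxx mul1r.
  rewrite big1 ?addr0 => [|e ee0].
    apply/eqP; rewrite addnC -conjzD (eq_prim_root_expr (conjz_prim k)).
    by rewrite ei.
  case: eqP => [eq1|]; last by rewrite mul0r.
  by case/eqP: ee0; apply: val_inj; apply: g_exp_mod_inj => //=; rewrite eq1 ei.
exists (fun e => \sum_(i < size F) F`_i * c1 i e) => [e|k].
  apply: eq_bigr => i _; rewrite /c1.
  suff -> : (g ^ (e + M) = g ^ e %[mod p])%N by [].
  by apply/eqP; rewrite g_eq modnDr.
rewrite horner_coef (size_map_inj_poly (@intr_inj C)) //.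
under [RHS]eq_bigr do rewrite rmorph_sum mulr_suml.
rewrite exchange_big /=; apply: eq_bigr => i _.
rewrite coef_map c1P mulr_sumr; apply: eq_bigr => e _.
by rewrite rmorphM /= mulrA.
Qed.

Section Periods.
Variables n m : nat.
Hypothesis Mnm : M = (n * m)%N.

Definition gauss_period j : C := \sum_(i < m) conjz (j + n * i).

(** The hypothesis says that the value is fixed by sigma^n. By [conjz_free] its coefficients on the
    conjugates are then [n]-periodic, and collecting equal coefficients produces the periods. *)
Lemma gauss_period_span (F : {poly int}) :
    evalz F (conjz n) = evalz F (conjz 0) ->
  exists a : 'I_n -> int,
    forall k, evalz F (conjz k) = \sum_(j < n) (a j)%:~R * gauss_period (j + k).
Proof.
have [c cM cF] := conjz_span F; rewrite !cF => c_eq.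
have nM : (n <= M)%N.
  have : (0 < M)%N by rewrite /M -subn1 subn_gt0 prime_gt1.
  by rewrite Mnm muln_gt0 => /andP[n0 m0]; rewrite leq_pmulr.
(* As [c] has period [M], the index [e + (M - n)] stands for [e - n]. *)
pose h e : C := (c (e + (M - n))%N)%:~R * conjz e.
have hM e : h (e + M)%N = h e by rewrite /h conjz_periodic addnAC cM.
have cn e : c (e + n)%N = c e.
  have cn' e' : (e' < M)%N -> c (e' + (M - n))%N = c e'.
    move=> e'M; apply/eqP; rewrite -subr_eq0; apply/eqP.
    apply: (conjz_free (c := fun e => c (e + (M - n))%N - c e)) e'M.
    under eq_bigr do rewrite rmorphB mulrBl.
    rewrite sumrB; apply/eqP; rewrite subr_eq0; apply/eqP.
    under [RHS]eq_bigr do rewrite -[X in conjz X]addn0.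
    rewrite -c_eq -(big_periodic_shift _ n hM).
    by apply: eq_bigr => i _; rewrite /h -addnA subnKC // cM.
  have cmod e' : c (e' %% M)%N = c e'.
    rewrite [in RHS](divn_eq e' M) addnC; elim: (e' %/ M)%N => [|q IHq].
      by rewrite mul0n addn0.
    by rewrite mulSn (addnC M) addnA cM.
  have M0 : (0 < M)%N by rewrite /M -subn1 subn_gt0 prime_gt1.
  have cn2 e' : c (e' + (M - n))%N = c e'.
    by rewrite -cmod -modnDml cmod cn' ?cmod // ltn_mod.
  by rewrite -cn2 -addnA subnKC ?cM.
exists (fun j => c j) => k; rewrite cF Mnm.
rewrite (big_mul_residues _ n m (fun e => (c e)%:~R * conjz (e + k))) /=.
apply: eq_bigr => j _; rewrite mulr_sumr; apply: eq_bigr => i _.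
rewrite addnAC; congr (_%:~R * _).
by elim: (i : nat) => [|i' IH]; rewrite ?muln0 ?addn0 // mulnS (addnC n) addnA cn.
Qed.

End Periods.
End GaussianPeriods.

(** * Cyclotomic units of a real cyclic field *)

Section CyclotomicUnits.
Variables (C : numClosedFieldType) (p g : nat) (w : C).
Hypotheses (pr_p : prime p) (prw : p.-primitive_root w) (cog : coprime g p).
Hypothesis g_eq : forall a b, (g ^ a == g ^ b %[mod p])%N = (a == b %[mod p.-1])%N.
Hypothesis g_surj :
  forall x, ~~ (p %| x)%N -> exists2 e, (e < p.-1)%N & (g ^ e = x %[mod p])%N.

Variables n m : nat.
Hypothesis Mnm : p.-1 = (n * m.*2)%N.

Notation conjz := (conjz g w).
Notation eta := (gauss_period g w n m.*2).
Definition theta j : C := \prod_(i < m.*2) (1 - conjz (j + n * i)).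
Definition cunit j : C := theta j.+1 / theta j.

Let conjzP := conjz_prim prw cog.
Let conjz_per := conjz_periodic prw g_eq.

Lemma nm_gt0 : (0 < n)%N && (0 < m)%N.
Proof.
have : (0 < p.-1)%N by rewrite -subn1 subn_gt0 prime_gt1.
by rewrite Mnm muln_gt0 double_gt0.
Qed.

Lemma gauss_period_periodic j : eta (j + n) = eta j.
Proof.
rewrite /gauss_period -[RHS](@big_periodic_shift _ _ _ m.*2 (fun i => conjz (j + n * i)) 1).
  by apply: eq_bigr => i _ /=; rewrite mulnDr muln1 -addnA (addnC n).
by move=> i /=; rewrite mulnDr -Mnm addnA conjz_per.
Qed.

Lemma theta_periodic j : theta (j + n) = theta j.
Proof.
rewrite /theta -[RHS](@big_periodic_shift _ _ _ m.*2 (fun i => 1 - conjz (j + n * i)) 1).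
  by apply: eq_bigr => i _ /=; rewrite mulnDr muln1 -addnA (addnC n).
by move=> i /=; rewrite mulnDr -Mnm addnA conjz_per.
Qed.

Lemma cunit_periodic j : cunit (j + n) = cunit j.
Proof. by rewrite /cunit -addSn !theta_periodic. Qed.

(** [g ^ (n * m)] is -1 mod [p], since its square is 1 and it is not 1 itself; and conjugation
    inverts roots of unity. *)
Lemma conjC_conjz e : (conjz e)^* = conjz (e + n * m).
Proof.
have p1 := prime_gt1 pr_p.
set a := (g ^ (n * m))%N.
have a1 : (p %| a + 1)%N.
  have : (p %| (a - 1) * (a + 1))%N.
    rewrite -subn_sqr exp1n -eqn_mod_dvd ?expn_gt0; last first.
      rewrite /a; case: (posnP g) cog => [->|//].
      by rewrite /coprime gcd0n gtn_eqF.
    rewrite /a -expnM muln2 -[1%N](expn0 g) g_eq Mnm -doubleMr modnn mod0n //.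
  rewrite Euclid_dvdM // => /orP[|//].
  rewrite -eqn_mod_dvd; last by rewrite /a expn_gt0; case: (posnP g) cog => [->|//]; rewrite /coprime gcd0n gtn_eqF.
  rewrite /a -[1%N](expn0 g) g_eq Mnm -doubleMr mod0n modn_small; last first.
    by rewrite -addnn -[ltnLHS]addn0 ltn_add2l muln_gt0 nm_gt0.
  by rewrite muln_eq0 => /orP[] /eqP x0; have := nm_gt0; rewrite x0 ?andbF.
have z1 := norm_prim_root (conjzP e).
have z0 : conjz e != 0 by rewrite -normr_eq0 z1 oner_eq0.
apply: (mulfI z0); rewrite -normCK z1 expr1n -conjzD -/a -exprS -addn1.
by apply/esym/eqP; rewrite -(prim_order_dvd (conjzP e)).
Qed.

Lemma eta_real j : eta j \is Num.real.
Proof.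
apply/CrealP; rewrite /gauss_period rmorph_sum /=.
under eq_bigr do rewrite conjC_conjz.
rewrite -[RHS](@big_periodic_shift _ _ _ m.*2 (fun i => conjz (j + n * i)) m).
  by apply: eq_bigr => i _; rewrite /= mulnDr addnA.
by move=> i /=; rewrite mulnDr -Mnm addnA conjz_per.
Qed.

Lemma sub1_conjz_neq0 e : 1 - conjz e != 0.
Proof.
rewrite subr_eq0 eq_sym -[conjz e]expr1 -(prim_order_dvd (conjzP e)).
by rewrite dvdn1 gtn_eqF ?prime_gt1.
Qed.

(** The factors of indices [i] and [i + m] are complex conjugate, so their product is a squared
    modulus. *)
Lemma theta_gt0 j : 0 < theta j.
Proof.
rewrite /theta -muln2 (big_mul_residues _ m 2 (fun i => 1 - conjz (j + n * i))) /=.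
apply: prodr_gt0 => i _; rewrite big_ord_recr big_ord1 /= muln0 addn0 muln1.
rewrite mulnDr addnA -conjC_conjz -[X in _ * (X - _)](rmorph1 Num.conj) -rmorphB /=.
by rewrite -normCK exprn_gt0 // normr_gt0 sub1_conjz_neq0.
Qed.

Lemma prod_theta : \prod_(j < n) theta j = p%:R.
Proof.
rewrite -(prod_1subconjz pr_p prw cog g_eq) Mnm.
by rewrite (big_mul_residues _ n m.*2 (fun i => 1 - conjz i)).
Qed.

Lemma cunit_gt0 j : 0 < cunit j.
Proof. by rewrite divr_gt0 ?theta_gt0. Qed.

Lemma prod_cunit : \prod_(j < n) cunit j = 1.
Proof.
rewrite big_split prodfV /=.
under eq_bigr do rewrite -addn1.
rewrite (big_periodic_shift _ _ theta_periodic) prod_theta divff //.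
by rewrite pnatr_eq0 -lt0n prime_gt0.
Qed.

Lemma sum_eta : \sum_(j < n) eta j = -1.
Proof.
rewrite -(sum_conjz pr_p prw cog g_eq 0) Mnm.
rewrite (big_mul_residues _ n m.*2 (fun i => conjz (i + 0))).
by apply: eq_bigr => j _; apply: eq_bigr => i _; rewrite addn0.
Qed.

(** The quotient (1 - y^g)/(1 - y) is 1 + y + ... + y^(g-1), so the unit lies in Z[zeta], given by
    one polynomial for all conjugates. *)
Lemma cunit_poly : exists U : {poly int}, forall k, evalz U (conjz k) = cunit k.
Proof.
exists (\prod_(i < m.*2) \sum_(t < g) 'X^(g ^ (n * i) * t)) => k.
apply: (mulIf (x := theta k)); first by rewrite gt_eqF ?theta_gt0.
rewrite divfK ?gt_eqF ?theta_gt0 // rmorph_prod horner_prod -big_split /=.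
apply: eq_bigr => i _; rewrite rmorph_sum horner_sum.
set y := conjz (k + n * i).
rewrite (eq_bigr (fun t : 'I_g => y ^+ t)) => [|t _]; last first.
  by rewrite /= map_polyXn hornerXn exprM conjzD.
by rewrite -(opprB y) mulrN mulrC -subrX1 opprB -[X in y ^+ X]expn1 conjzD addn1.
Qed.

Lemma theta_poly :
  exists T : {poly int}, forall k, evalz T (conjz k) = theta k.
Proof.
exists (\prod_(i < m.*2) (1 - 'X^(g ^ (n * i)))) => k.
rewrite rmorph_prod horner_prod; apply: eq_bigr => i _.
by rewrite /= rmorphB rmorph1 /= map_polyXn !hornerE conjzD.
Qed.

Lemma gauss_period_poly j :
  exists T : {poly int}, forall k, evalz T (conjz k) = eta (k + j).
Proof.
exists (\sum_(i < m.*2) 'X^(g ^ (j + n * i))) => k.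
rewrite rmorph_sum horner_sum; apply: eq_bigr => i _.
by rewrite /= map_polyXn !hornerE conjzD addnA.
Qed.

(** As [a] is independent of [k], one integer matrix represents multiplication by the unit in all
    embeddings. *)
Lemma cunit_mul_period j :
  exists a : 'I_n -> int,
    forall k, cunit k * eta (k + j) = \sum_(t < n) (a t)%:~R * eta (t + k).
Proof.
have [U UE] := cunit_poly; have [T TE] := gauss_period_poly j.
have [|a aE] := gauss_period_span pr_p prw cog g_eq g_surj Mnm (F := U * T).
  by rewrite rmorphM !hornerM /= !UE !TE -[in cunit n](add0n n) cunit_periodic (addnC n) gauss_period_periodic.
by exists a => k; rewrite -aE rmorphM hornerM /= UE TE.
Qed.

Lemma root_cunit (f : {poly rat}) a b :
  root (map_poly ratr f) (cunit a) -> root (map_poly ratr f) (cunit b).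
Proof.
have [U UE] := cunit_poly.
have mapU : map_poly intr U = map_poly ratr (map_poly intr U) :> {poly C}.
  by rewrite -map_poly_comp; apply: eq_map_poly => x; rewrite /= ratr_int.
have compE k : root (map_poly ratr f) (cunit k) =
    root (map_poly ratr (f \Po map_poly intr U)) (conjz k).
  by rewrite map_comp_poly /root horner_comp -mapU UE.
by rewrite !compE; apply: (root_conjz pr_p prw cog).
Qed.

(** With e = gcd(n, d), theta is [e]-periodic, so its norm [p] is the (n/e)-th power of [P]. This
    [P] is fixed by sigma, hence a rational integer, and comparing [p]-adic valuations gives e =
    n. *)
Lemma theta_period_dvd d : (forall c, theta (c + d) = theta c) -> (n %| d)%N.
Proof.
move=> thd; have [n0 _] := andP nm_gt0.
pose e := gcdn n d; have en : (e %| n)%N by apply: dvdn_gcdl.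
have mulper (q x : nat) : (forall c, theta (c + x) = theta c) ->
    forall c, theta (c + q * x) = theta c.
  move=> thx c; elim: q => [|q IHq]; first by rewrite addn0.
  by rewrite mulSn (addnC x) addnA thx.
have the c : theta (c + e) = theta c.
  have [km kn def_e _] := egcdnP d n0.
  by rewrite -(mulper kn _ thd) -addnA (addnC e) -def_e mulper //; apply: theta_periodic.
have [T TE] := theta_poly.
pose P := \prod_(c < e) theta c.
have [Q QE] : exists Q : {poly int}, forall k, evalz Q (conjz k) = P.
  exists (\prod_(c < e) (T \Po 'X^(g ^ c))) => k.
  rewrite rmorph_prod horner_prod /P -(big_periodic_shift _ k the).
  apply: eq_bigr => c _.
  by rewrite /= map_comp_poly map_polyXn horner_comp hornerXn conjzD TE addnC.
(* With a single period, the full trace -1, the span consists of the integers. *)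
have M1 : p.-1 = (1 * p.-1)%N by rewrite mul1n.
have [|a aE] := gauss_period_span pr_p prw cog g_eq g_surj M1 (F := Q); first by rewrite !QE.
have := aE 0%N; rewrite QE big_ord1 /gauss_period /= addn0.
under eq_bigr do rewrite add0n mul1n -[X in conjz X]addn0.
rewrite (sum_conjz pr_p prw cog g_eq) mulrN1 -rmorphN /= => PE.
have := prod_theta; rewrite -(divnK en) mulnC.
rewrite (big_mul_residues _ e (n %/ e) theta).
rewrite (eq_bigr (fun c : 'I_e => theta c ^+ (n %/ e))) => [|c _]; last first.
  rewrite (eq_bigr (fun=> theta c)) ?prodr_const ?card_ord // => i _.
  by rewrite mulnC mulper.
rewrite prodrXl -/P PE -rmorphXn pmulrn /= => /eqP; rewrite eqr_int => /eqP.
move/(congr1 (fun x : int => logn p `|x|)); rewrite /= abszX lognX (logn_prime _ pr_p) eqxx.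
move/eqP; rewrite muln_eq1 => /andP[/eqP ne1 _].
by rewrite ne1 muln1 dvdn_gcdr.
Qed.

(** A coincidence at distance [d] propagates to all conjugates, which makes theta(c + d)/theta(c)
    independent of [c]. Its [n]-th power is 1 and it is positive, so it equals 1, and
    [theta_period_dvd] applies to [d < n]. *)
Lemma cunit_inj a b : (a < n)%N -> (b < n)%N -> cunit a = cunit b -> a = b.
Proof.
wlog ab : a b / (a <= b)%N => [hw|] an bn uab.
  by have [/hw|/ltnW/hw] := leqP a b; [exact|move=> h; apply/esym/h].
have [n0 _] := andP nm_gt0.
pose d := (b - a)%N.
have [U UE] := cunit_poly.
have ud c : cunit (c + d) = cunit c.
  have compE k : evalz (U \Po 'X^(g ^ d) - U) (conjz k) = cunit (k + d) - cunit k.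
    by rewrite rmorphB hornerD hornerN /= map_comp_poly map_polyXn horner_comp hornerXn conjzD !UE.
  apply/eqP; rewrite -subr_eq0 -compE; apply/eqP.
  apply: (root_int_conjz pr_p prw cog (a := a)).
  by rewrite compE subnKC // uab subrr.
have th0 k : theta k != 0 by rewrite gt_eqF ?theta_gt0.
pose q c := theta (c + d) / theta c.
have qS c : q c.+1 = q c.
  have := ud c; rewrite /cunit /q -addSn => /eqP.
  rewrite eqr_div // => /eqP E; apply/eqP; rewrite eqr_div //.
  by rewrite E mulrC.
have q0 c : q c = q 0%N by elim: c => // c <-.
have q1 : q 0%N = 1.
  have : \prod_(c < n) q c = 1.
    rewrite big_split prodfV /= (big_periodic_shift _ _ theta_periodic) divff //.
    by apply/prodf_neq0.
  rewrite (eq_bigr (fun=> q 0%N)) ?prodr_const ?card_ord // => /eqP.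
  by rewrite pexpr_eq1 // => [/eqP//|]; rewrite divr_ge0 // ltW ?theta_gt0.
have /dvdn_leq : (n %| d)%N.
  by apply: theta_period_dvd => c; apply: divr1_eq; rewrite -/(q c) q0.
move=> nd; apply/eqP; rewrite eqn_leq ab leqNgt; apply/negP => lab.
by move: nd; rewrite /d subn_gt0 (leqNgt n) (leq_ltn_trans (leq_subr _ _) bn) => /(_ lab).
Qed.

End CyclotomicUnits.

Lemma prim_root_exists (C : numClosedFieldType) (p : nat) :
  prime p -> exists w : C, p.-primitive_root w.
Proof.
move=> pr_p; have p1 := prime_gt1 pr_p.
have /closed_rootP[w] : size (\sum_(i < p) 'X^i : {poly C}) != 1%N.
  by rewrite size_sum_Xn gtn_eqF.
by exists w; apply: root_sum_Xn_prim; rewrite // pnatr_eq0 -lt0n ltnW.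
Qed.

(* [u j] runs through the conjugates of a unit of a real cyclic field of       *)
(* degree n, [eta j] through those of a generator of a normal integral basis,  *)
(* and [A] is the matrix of multiplication by the unit in that basis.          *)
Lemma cyclic_unit_exists (C : numClosedFieldType) (n : nat) : (1 < n)%N ->
  exists (A : 'M[int]_n) (u eta : nat -> C),
    [/\ (forall j, u j \is Num.real /\ eta j \is Num.real),
        (forall j, u (j + n)%N = u j /\ eta (j + n)%N = eta j),
        (\prod_(j < n) u j = 1 /\ \sum_(j < n) eta j = -1),
        (forall k (j : 'I_n), u k * eta (k + j)%N = \sum_(t < n) (A t j)%:~R * eta (t + k)%N)
      & (forall a b, (a < n)%N -> (b < n)%N -> u a = u b -> a = b) /\
        (forall (f : {poly rat}) a b,
          root (map_poly ratr f) (u a) -> root (map_poly ratr f) (u b))].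
Proof.
move=> n1.
have [p pr_p /dvdnP[m pE]] : exists2 p, prime p & (n.*2 %| p.-1)%N.
  by apply: prime_1modn_exists; rewrite -addnn (leq_trans n1) ?leq_addr.
have Mnm : p.-1 = (n * m.*2)%N by rewrite pE mulnC -!muln2 -mulnA (mulnC 2).
have [g [cog g_eq g_surj]] := primitive_root_modp pr_p.
have [w prw] := prim_root_exists C pr_p.
have [A AE] := fin_all_exists
  (fun j : 'I_n => cunit_mul_period pr_p prw cog g_eq g_surj Mnm j).
exists (\matrix_(t, j) A j t), (cunit g w n m), (gauss_period g w n m.*2).
split=> [j|j||k j|].
- split; last exact: (eta_real pr_p).
  by rewrite gtr0_real // (cunit_gt0 pr_p prw cog g_eq).
- by rewrite (cunit_periodic prw g_eq) ?(gauss_period_periodic prw g_eq).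
- by rewrite (prod_cunit pr_p prw cog g_eq) ?(sum_eta pr_p prw cog g_eq).
- by rewrite AE; apply: eq_bigr => t _; rewrite mxE.
- split; first exact: (cunit_inj pr_p prw cog g_eq g_surj).
  exact: (root_cunit pr_p prw cog g_eq).
Qed.

Lemma real_cyclic_unit_exists (R : realType) (n : nat) : (1 < n)%N ->
  exists (A : 'M[int]_n) (u eta : nat -> R),
    [/\ (forall j, u (j + n)%N = u j /\ eta (j + n)%N = eta j),
        (\prod_(j < n) u j = 1 /\ \sum_(j < n) eta j = -1),
        (forall k (j : 'I_n), u k * eta (k + j)%N = \sum_(t < n) (A t j)%:~R * eta (t + k)%N)
      & (forall a b, (a < n)%N -> (b < n)%N -> u a = u b -> a = b) /\
        (forall (f : {poly rat}) a b,
          root (map_poly ratr f) (u a) -> root (map_poly ratr f) (u b))].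
Proof.
move=> /(cyclic_unit_exists R[i]) [A [u [eta [re per [pu se] Aeq [u_inj u_root]]]]].
pose c : {rmorphism R -> R[i]} := real_complex R.
pose re_part (z : R[i]) : R := complex.Re z.
have uE j : u j = c (re_part (u j)) by rewrite [RHS]RRe_real //; case: (re j).
have etaE j : eta j = c (re_part (eta j)) by rewrite [RHS]RRe_real //; case: (re j).
have inj : injective c by apply: fmorph_inj.
exists A, (re_part \o u), (re_part \o eta); split=> [j||k j|] /=.
- by have [-> ->] := per j.
- split; apply: inj.
    by rewrite rmorph_prod rmorph1 -[RHS]pu; apply: eq_bigr => j _; rewrite [RHS]uE.
  by rewrite rmorph_sum rmorphN1 -[RHS]se; apply: eq_bigr => j _; rewrite [RHS]etaE.
- apply: inj; rewrite rmorphM rmorph_sum /= -uE -etaE Aeq.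
  by apply: eq_bigr => t _; rewrite rmorphM rmorph_int /= -etaE.
- split=> [a b an bn uab|f a b]; first by apply: u_inj; rewrite // uE uab -uE.
  have rootE k : root (map_poly ratr f) (re_part (u k)) = root (map_poly ratr f) (u k).
    rewrite -(fmorph_root c). rewrite -uE -map_poly_comp.
    by congr (root _ _); apply: eq_map_poly => x /=; rewrite fmorph_rat.
  by rewrite !rootE; apply: u_root.
Qed.

(** * Matrices with distinct conjugate eigenvalues *)

(** Eigenspaces of distinct eigenvalues are in direct sum; n nonzero ones in dimension n are all
    lines. This gives the invertibility of the matrix of periods without computing its
    determinant. *)
Lemma eigenspace_lines (F : fieldType) n (B V : 'M[F]_n) (x : 'I_n -> F) :
    injective x -> (forall i, row i V *m B = x i *: row i V) ->
    (forall i, row i V != 0) ->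
  V \in unitmx /\ forall i, (eigenspace B (x i) :=: row i V)%MS.
Proof.
move=> x_inj VB V0; pose E i := eigenspace B (x i).
have rowE i : (row i V <= E i)%MS by apply/eigenspaceP.
have rk_row i : \rank (row i V) = 1%N by rewrite rank_rV V0.
have rkE1 i : (1 <= \rank (E i))%N by rewrite -(rk_row i) mxrankS.
have rkS : \rank (\sum_i E i)%MS = (\sum_i \rank (E i))%N.
  by apply/mxdirectP/mxdirect_sum_eigenspace => i j _ _; apply: x_inj.
have sum1 : (\sum_(i < n) 1 <= \sum_i \rank (E i) ?= iff [forall i, 1%N == \rank (E i)])%N.
  by apply: leqif_sum => i _; split=> //; apply: rkE1.
have sumn : \sum_i \rank (E i) = n.
  apply/eqP; rewrite eqn_leq -rkS rank_leq_col rkS.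
  by have := sum1.1; rewrite sum1_card card_ord.
have /forallP rkE : [forall i, 1%N == \rank (E i)].
  by rewrite -sum1 sumn sum1_card card_ord.
have Erow i : (E i :=: row i V)%MS.
  apply/eqmx_sym/eqmxP; rewrite -(mxrank_leqif_eq (rowE i)).
  by rewrite rk_row (eqP (rkE i)).
split=> //; rewrite -row_free_unit -row_leq_rank -[leqLHS]sumn -rkS mxrankS //.
by apply/sumsmx_subP => i _; rewrite Erow row_sub.
Qed.

Lemma char_poly_eigen (F : fieldType) n (B : 'M[F]_n) (x : 'I_n -> F) :
    injective x -> (forall i, eigenvalue B (x i)) ->
  char_poly B = \prod_(i < n) ('X - (x i)%:P).
Proof.
move=> x_inj Bx.
rewrite [LHS](@all_roots_prod_XsubC _ _ [seq x i | i <- enum 'I_n]).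
- by rewrite (monicP (char_poly_monic B)) scale1r big_map big_enum.
- by rewrite size_char_poly size_map size_enum_ord.
- by apply/allP => _ /mapP[i _ ->]; rewrite -eigenvalue_root_char.
- by rewrite uniq_rootsE map_inj_uniq ?enum_uniq.
Qed.

(** A nonconstant factor has some [x i] as a root, hence all of them, hence is divisible by the
    whole product. *)
Lemma irreducible_conjugates (F : numFieldType) n (P : {poly rat}) (x : 'I_n -> F) :
    (0 < n)%N -> injective x ->
    map_poly ratr P = \prod_(i < n) ('X - (x i)%:P) ->
    (forall (f : {poly rat}) i j,
      root (map_poly ratr f) (x i) -> root (map_poly ratr f) (x j)) ->
  irreducible_poly P.
Proof.
move=> n0 x_inj PE conj; split.
  rewrite -(size_map_poly (@ratr F)) PE -big_enum /=.
  by rewrite size_prod_XsubC size_enum_ord.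
move=> q q1 qP; rewrite /eqp qP /= -(dvdp_map (@ratr F)).
have [i xi] : exists i, root (map_poly ratr q) (x i).
  move: qP; rewrite -(dvdp_map (@ratr F)) /= PE.
  move=> /dvdp_prod_XsubC[msk qE].
  have : size (\prod_(i <- mask msk (index_enum 'I_n)) ('X - (x i)%:P)) != 1%N.
    by rewrite -(eqp_size qE) size_map_poly.
  case mE : (mask _ _) => [|i s]; first by rewrite big_nil size_polyC oner_eq0.
  move=> _; exists i; rewrite (eqp_root qE) mE big_cons rootM root_XsubC eqxx //.
rewrite /= PE -[X in X %| _](big_map x predT (fun a => 'X - a%:P)).
apply: uniq_roots_dvdp.
  by apply/allP => _ /mapP[j _ ->]; apply: conj xi.
by rewrite uniq_rootsE map_inj_uniq ?index_enum_uniq.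
Qed.

(** * Klein polyhedra and sails *)

Local Open Scope classical_set_scope.

Lemma continuous_mx (R : realType) (T : topologicalType) m n (f : T -> 'M[R]_(m, n)) :
  (forall i j, continuous (fun x => f x i j)) -> continuous f.
Proof.
move=> cf x A [P Pn sPA].
have : \forall y \near x, forall ij : 'I_m * 'I_n, P ij.1 ij.2 (f y ij.1 ij.2).
  by apply: filter_forall => -[i j]; apply: cf; apply: Pn.
by apply: filterS => y Py; apply: sPA => i j; apply: (Py (i, j)).
Qed.

Lemma continuous_sum (R : realType) (T : topologicalType) (I : Type) (s : seq I)
    (F : I -> T -> R) :
  (forall i, continuous (F i)) -> continuous (fun x => \sum_(i <- s) F i x).
Proof.
move=> cF; elim: s => [|i s IHs] x.
  by under eq_fun do rewrite big_nil; apply: cvg_cst.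
under eq_fun do rewrite big_cons.
by apply: cvgD; [apply: cF|apply: IHs].
Qed.

Lemma mulmx_continuous (R : realType) m n p (B : 'M[R]_(n, p)) :
  continuous (fun x : 'M[R]_(m, n) => x *m B).
Proof.
apply: continuous_mx => i j.
under eq_fun do rewrite mxE.
apply: continuous_sum => k x; apply: continuousM; last exact: cst_continuous.
exact: (@coord_continuous R m n i k x).
Qed.

Lemma convex_hull_sub (R : realType) n (X : set 'rV[R]_n) : X `<=` convex_hull X.
Proof. exact: sub_gen_smallest. Qed.

Lemma convex_hull_convex (R : realType) n (X : set 'rV[R]_n) :
  @convex_set R 'rV[R]_n (convex_hull X).
Proof.
move=> x y t; rewrite !inE => hx hy Y [Yc XY].
by have := Yc x y t; rewrite !inE; apply; [apply: hx|apply: hy].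
Qed.

Lemma convex_hull_image (R : realType) n (B : 'M[R]_n) (X : set 'rV[R]_n) x :
  convex_hull X x -> convex_hull [set y *m B | y in X] (x *m B).
Proof.
pose Y : set 'rV[R]_n := [set y | convex_hull [set y *m B | y in X] (y *m B)].
suff : convex_hull X `<=` Y by apply.
apply: smallest_sub => [y z t|y Xy]; last by apply: convex_hull_sub; exists y.
rewrite !inE /Y /= => hy hz.
have := @convex_hull_convex R n [set y *m B | y in X] (y *m B) (z *m B) t.
rewrite !inE => /(_ hy hz).
suff -> : (conv t (y : convex_lmodType 'rV[R]_n) z : 'rV[R]_n) *m B = conv t (y *m B : convex_lmodType 'rV[R]_n) (z *m B) by [].
by rewrite /conv /= mulmxDl -!scalemxAl.
Qed.

Lemma closure_image (T U : topologicalType) (f : T -> U) (X : set T) x :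
  continuous f -> closure X x -> closure (f @` X) (f x).
Proof.
move=> cf Xx A /cf /Xx[y [Xy Ay]].
by exists (f y); split => //; exists y.
Qed.

Lemma connected_component_image (T U : topologicalType) (f : T -> U)
    (A : set T) (A' : set U) x :
  continuous f -> (forall y, A y -> A' (f y)) ->
  f @` connected_component A x `<=` connected_component A' (f x).
Proof.
move=> cf AA' _ [y [D [Dx DA Dc] Dy] <-]; exists (f @` D); last by exists y.
split; [by exists x|by move=> _ [z /DA/AA' Az <-]|].
by apply: connected_continuous_connected => //; apply: continuous_subspaceT.
Qed.

(** * Linear bijections preserving the arrangement and the lattice *)

Section ImageByLattice.
Variables (R : realType) (n : nat) (l : 'I_n -> 'M[R]_n) (B B' : 'M[R]_n).
Hypotheses (BB' : B *m B' = 1%:M) (B'B : B' *m B = 1%:M).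
Hypothesis offB : forall x, off_hyperplanes l (x *m B) <-> off_hyperplanes l x.
Hypothesis intB : forall x, integer_points (x *m B) <-> integer_points x.

Let f (x : 'rV[R]_n) := x *m B.
Let f' (x : 'rV[R]_n) := x *m B'.
Let fK : cancel f f'. Proof. by move=> x; rewrite /f /f' -mulmxA BB' mulmx1. Qed.
Let f'K : cancel f' f. Proof. by move=> x; rewrite /f /f' -mulmxA B'B mulmx1. Qed.

Let image_eq (F F' : set 'rV[R]_n) :
  f @` F `<=` F' -> f' @` F' `<=` F -> f @` F = F'.
Proof.
move=> FF' F'F; apply/seteqP; split=> // y F'y; exists (f' y); last exact: f'K.
by apply: F'F; exists y.
Qed.

Let off' x : off_hyperplanes l (f' x) <-> off_hyperplanes l x.
Proof. by rewrite -offB -[_ *m B]/(f _) f'K. Qed.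

Let int' x : integer_points (f' x) <-> integer_points x.
Proof. by rewrite -intB -[_ *m B]/(f _) f'K. Qed.

Lemma cone_image x :
  f @` closure (connected_component (off_hyperplanes l) x) =
  closure (connected_component (off_hyperplanes l) (f x)).
Proof.
have comp_eq : f @` connected_component (off_hyperplanes l) x =
    connected_component (off_hyperplanes l) (f x).
  apply: image_eq; first by apply: connected_component_image => [|y /offB //]; apply: mulmx_continuous.
  rewrite -[X in _ `<=` connected_component _ X]fK.
  by apply: connected_component_image => [|y /off' //]; apply: mulmx_continuous.
rewrite -comp_eq; apply: image_eq => _ [y Cy <-].
  by apply: closure_image => //; apply: mulmx_continuous.
have := closure_image (@mulmx_continuous R 1 n n B') Cy.
congr (closure _ _); apply/seteqP; split=> [_ [_ [z Cz <-] <-]|z Cz].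
  by rewrite -/(f' _) fK.
by exists (f z); [exists z|apply: fK].
Qed.

Lemma klein_polyhedron_image (C : set 'rV[R]_n) :
  f @` klein_polyhedron C = klein_polyhedron (f @` C).
Proof.
have imE : f @` ((C `&` @integer_points R n) `\ 0) =
    (f @` C `&` @integer_points R n) `\ 0.
  apply: image_eq => [_ [x [[Cx Zx] x0] <-]|_ [_ [[[x Cx <-] /intB Zx] x0] <-]].
    split; first by split; [exists x|apply/intB].
    by move=> /= fx0; apply: x0; rewrite /= -[x]fK fx0 /f' mul0mx.
  rewrite fK; split=> // /= x00; apply: x0; by rewrite /= x00 /f mul0mx.
apply: image_eq => [_ [x Kx <-]|_ [x Kx <-]].
  by rewrite /klein_polyhedron -imE; apply: convex_hull_image.
move: Kx; rewrite /klein_polyhedron -imE => /(@convex_hull_image _ _ B' _ _).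
congr (convex_hull _ _); apply/seteqP; split=> [_ [_ [z Cz <-] <-]|z Cz].
  by rewrite -/(f' _) fK.
by exists (f z); [exists z|apply: fK].
Qed.

(** Such a map is a linear homeomorphism, so it commutes with components, closures, convex hulls and
    boundaries. The reverse inclusion will come from the inverse map. *)
Lemma CF_image x : CF l x -> CF l (x *m B).
Proof.
move=> [_ [x0 offx0 <-]] [clx intx].
exists (closure (connected_component (off_hyperplanes l) (f x0))).
  by exists (f x0) => //; apply/offB.
rewrite -cone_image /sail -klein_polyhedron_image; split.
  exact: closure_image (@mulmx_continuous R 1 n n B) clx.
move=> /(@mulmx_continuous R 1 n n B x) fx; apply: intx.
by apply: (@filterS _ (nbhs x) _ _ _ _ fx) => y [z Kz /(can_inj fK) <-].
Qed.

End ImageByLattice.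

Lemma operatorM (R : realType) n (A B : 'M[int]_n) :
  operator R (A *m B) = operator R A *m operator R B.
Proof. by rewrite /operator map_mxM. Qed.

Lemma operator1 (R : realType) n : operator R (1%:M : 'M[int]_n) = 1%:M.
Proof. by rewrite /operator map_mx1. Qed.

Lemma integer_points_operator (R : realType) n (G : 'M[int]_n) (x : 'rV[R]_n) :
  integer_points x -> integer_points (x *m operator R G).
Proof. by move=> [z _ <-]; exists (z *m G) => //; rewrite map_mxM. Qed.

Lemma hyperplane_permutes (R : realType) n (l : 'I_n -> 'M[R]_n) (G : 'M[int]_n) s i :
  permutes_lines l G s -> (hyperplane l i *m operator R G :=: hyperplane l (s i))%MS.
Proof.
move=> Gs; apply: (eqmx_trans (sumsmxMr _ _ _)).
have -> : hyperplane l (s i) = (\sum_(j < n | j != i) l (s j))%MS.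
  rewrite /hyperplane (reindex_inj (@perm_inj _ s)) /=.
  by apply: eq_bigl => j; rewrite (inj_eq perm_inj).
by apply: eqmx_sums => j _; apply: Gs.
Qed.

Lemma permutes_lines_symmetry (R : realType) n (l : 'I_n -> 'M[R]_n) (G : 'M[int]_n) s :
  G \in unitmx -> permutes_lines l G s -> symmetry l G.
Proof.
move=> Gu Gs; split=> //.
pose H := invmx G.
have GH : operator R G *m operator R H = 1%:M by rewrite -operatorM mulmxV ?operator1.
have HG : operator R H *m operator R G = 1%:M by rewrite -operatorM mulVmx ?operator1.
have freeG : row_free (operator R G) by rewrite row_free_unit; case/mulmx1_unit: GH.
have offG x : off_hyperplanes l (x *m operator R G) <-> off_hyperplanes l x.
  have E i : (x *m operator R G <= hyperplane l (s i))%MS = (x <= hyperplane l i)%MS.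
    by rewrite -(hyperplane_permutes i Gs) submxMfree.
  split=> offx i; first by rewrite -E.
  by rewrite -(permKV s i) E.
have intG (x : 'rV[R]_n) : integer_points (x *m operator R G) <-> integer_points x.
  split; last exact: integer_points_operator.
  by move=> /(integer_points_operator H); rewrite -mulmxA GH mulmx1.
have offG' x : off_hyperplanes l (x *m operator R H) <-> off_hyperplanes l x.
  by rewrite -offG -mulmxA HG mulmx1.
have intG' (x : 'rV[R]_n) : integer_points (x *m operator R H) <-> integer_points x.
  by rewrite -intG -mulmxA HG mulmx1.
apply/seteqP; split=> [_ [x Fx <-]|x Fx]; first exact: (CF_image GH HG offG intG).
exists (x *m operator R H); last by rewrite -mulmxA HG mulmx1.
exact: (CF_image HG GH offG' intG').
Qed.

Lemma mulmx_col (R : pzSemiRingType) m n p (A : 'M[R]_(m, n)) (B : 'M[R]_(n, p)) j :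
  A *m col j B = col j (A *m B).
Proof. by rewrite !colE mulmxA. Qed.

(** * Coordinates along the lines, and a point on a sail *)

Section Basis.
Variables (R : realType) (n : nat) (l : 'I_n -> 'M[R]_n) (V : 'M[R]_n).
Hypotheses (Vu : V \in unitmx) (lV : forall i, (l i :=: row i V)%MS).

(** Column [i] of [invmx V] is the linear form dual to row [i] of [V]; its kernel is spanned by the
    other lines. *)
Lemma hyperplane_coord i (x : 'rV[R]_n) :
  (x <= hyperplane l i)%MS = ((x *m invmx V) 0 i == 0).
Proof.
apply/idP/eqP => [|x0].
  have Hker : (hyperplane l i <= kermx (col i (invmx V)))%MS.
    apply/sumsmx_subP => j ji; rewrite lV; apply/sub_kermxP.
    by rewrite -row_mul mulmx_col mulmxV //; apply/matrixP => a b; rewrite !mxE (negbTE ji).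
  move=> /submx_trans/(_ Hker)/sub_kermxP; rewrite mulmx_col => /matrixP/(_ 0 0).
  by rewrite [LHS]mxE [RHS]mxE.
rewrite -[x](mulmxKV Vu) mulmx_sum_row; apply: summx_sub => j _.
have [->|ji] := eqVneq j i; first by rewrite x0 scale0r sub0mx.
by apply/scalemx_sub/(submx_trans _ (sumsmx_sup j _ _)) => //; rewrite lV.
Qed.

(* The functional psi is the coordinate along l_i normalised by psi e = 1. It  *)
(* is nonnegative on the cone C of e, hence on its Klein polyhedron K, so the  *)
(* line R e meets K and its complement.                                        *)
Lemma sail_meets_line (i : 'I_n) (e : 'rV[R]_n) :
    integer_points e -> off_hyperplanes l e ->
  exists2 C, cones l C & exists t, sail C (t *: e).
Proof.
move=> Ze offe.
pose D := connected_component (off_hyperplanes l) e.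
have De : D e by apply: connected_component_refl.
exists (closure D); first by exists e.
pose a := (e *m invmx V) 0 i; have a0 : a != 0.
  by rewrite -hyperplane_coord.
pose psi (x : 'rV[R]_n) : R := (x *m (a^-1 *: col i (invmx V))) 0 0.
have psiE x : psi x = a^-1 * (x *m invmx V) 0 i.
  by rewrite /psi -scalemxAr mulmx_col !mxE.
have psi1 : psi e = 1 by rewrite psiE mulVf.
have psi_cont : continuous psi.
  move=> x; rewrite /psi; set c := _ *: _.
  have := @continuous_comp _ _ _ (fun y : 'rV[R]_n => y *m c)
    (fun M : 'M[R]_1 => M 0 0) x; apply.
    exact: mulmx_continuous.
  exact: (@coord_continuous R 1 1 0 0 (x *m c)).
have psiZ t x : psi (t *: x) = t * psi x.
  by rewrite !psiE -scalemxAl mxE mulrCA.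
(* The values of [psi] on the connected set [D] form an interval that contains [psi e = 1] and
   misses 0, as [D] avoids the hyperplane. *)
have psi_D : psi @` D `<=` [set t | 0 < t].
  have /connected_intervalP itvD : connected (psi @` D).
    apply: connected_continuous_connected; first exact: component_connected.
    exact: continuous_subspaceT.
  move=> _ [x Dx <-] /=; rewrite ltNge; apply/negP => psix.
  have [] : (psi @` D) 0.
    apply: (itvD (psi x) 1); [by exists x|by exists e|by rewrite psix ler01].
  move=> y /connected_component_sub/(_ i); rewrite hyperplane_coord.
  by move=> y0 /eqP; rewrite psiE mulf_eq0 invr_eq0 (negbTE a0) (negbTE y0).
have psi_K : klein_polyhedron (closure D) `<=` [set x | 0 <= psi x].
  apply: smallest_sub => [x y t|x [[Cx _] _] /=].
    rewrite !inE /= => x0 y0.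
    have -> : psi (conv t (x : convex_lmodType 'rV[R]_n) y) =
        t%:num * psi x + (1 - t%:num) * psi y.
      by rewrite -!psiZ /psi mulmxDl [LHS]mxE.
    by rewrite addr_ge0 // mulr_ge0 // subr_ge0.
  have := closure_image psi_cont Cx.
  by move=> /(closureS psi_D); rewrite closure_gt.
(* If the line missed the sail, the preimage of [K] under [g] would be open, closed and nonempty,
   hence all of R, whereas [psi] is -1 at [g (-1)]. *)
apply: contrapT => /forallNP no_sail.
pose K := klein_polyhedron (closure D); pose g (t : R) := t *: e.
have K_e : K e.
  apply: convex_hull_sub; split; first by split=> //; apply: subset_closure.
  by move=> /= e0; move/eqP: psi1; rewrite e0 psiE mul0mx mxE mulr0 eq_sym oner_eq0.
have K_int t : closure K (g t) -> K° (g t).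
  by move=> clK; apply: contrapT => intK; apply: (no_sail t).
have g_cont : continuous g.
  apply: continuous_mx => j k; rewrite /g; under eq_fun do rewrite mxE.
  by move=> t; apply: continuousM; [exact: id|exact: cst_continuous].
have /connected_intervalP RC : is_interval [set: R] by [].
have : g @^-1` K = [set: R].
  apply: RC; first by exists 1; rewrite /g /= scale1r.
    exists (g @^-1` K); last by rewrite setTI.
    rewrite openE => t Kt; apply: g_cont; apply: (K_int t).
    exact: subset_closure.
  exists (g @^-1` K); last by rewrite setTI.
  move=> t clt; apply: (@interior_subset _ K); apply: K_int.
  have := closure_image g_cont clt; apply: closureS => _ [s Ks <-] //.
move=> /seteqP[_ /(_ (-1) I)] /= /psi_K /=.
by rewrite /g psiZ psi1 mulr1 oppr_ge0 lt_geF ?ltr01.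
Qed.

End Basis.

Local Close Scope classical_set_scope.

(** * The operator attached to a cyclotomic unit *)

Section CyclicShift.
Variable n : nat.

Definition shift_perm : 'S_n := perm (@ordS_inj n).

Lemma shift_perm_porbit (i : 'I_n) : porbit shift_perm i = [set: 'I_n]%SET.
Proof.
have shiftX k : ((shift_perm ^+ k)%g i = (i + k) %% n :> nat)%N.
  elim: k => [|k IHk]; first by rewrite expg0 perm1 addn0 modn_small.
  by rewrite expgSr permM permE /= IHk -addn1 modnDml addn1 addnS.
apply/finset.setP => j; rewrite finset.in_setT.
have -> : j = (shift_perm ^+ (j + (n - i)))%g i.
  apply: val_inj; rewrite /= shiftX addnCA subnKC ?(ltnW (ltn_ord i)) //.
  by rewrite modnDr modn_small.
exact: mem_porbit.
Qed.

End CyclicShift.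

Section FromUnit.
Variables (R : realType) (n : nat) (A : 'M[int]_n) (u eta : nat -> R).
Hypothesis n1 : (1 < n)%N.
Hypotheses (u_per : forall j, u (j + n)%N = u j)
  (eta_per : forall j, eta (j + n)%N = eta j).
Hypotheses (prod_u : \prod_(j < n) u j = 1) (sum_eta : \sum_(j < n) eta j = -1).
Hypothesis A_eq : forall k (j : 'I_n),
  u k * eta (k + j)%N = \sum_(t < n) (A t j)%:~R * eta (t + k)%N.
Hypothesis u_inj : forall a b, (a < n)%N -> (b < n)%N -> u a = u b -> a = b.
Hypothesis u_root : forall (f : {poly rat}) a b,
  root (map_poly ratr f) (u a) -> root (map_poly ratr f) (u b).

Let x (i : 'I_n) := u i.
(** Row [i] lists the images of the basis of periods in the [i]-th embedding, an eigenvector of A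
    for [u i]. *)
Let V : 'M[R]_n := \matrix_(i, j) eta (i + j)%N.
Let l (i : 'I_n) : 'M[R]_n := eigenspace (operator R A) (x i).
(** Multiplying a row vector by this matrix puts its coordinate of index j+1 mod n at place j, so
    row [i] of [V] becomes the next row, cyclically. This is sigma on the periods. *)
Let G : 'M[int]_n := perm_mx (shift_perm n)^-1.

Lemma unit_conj_inj : injective x.
Proof. by move=> i j /u_inj ij; apply: val_inj; apply: ij. Qed.

Lemma period_row_eigen i : row i V *m operator R A = x i *: row i V.
Proof.
apply/rowP => j; rewrite !mxE A_eq; apply: eq_bigr => t _.
by rewrite !mxE mulrC addnC.
Qed.

Lemma sum_period_row i : \sum_j V i j = -1.
Proof.
rewrite -sum_eta -(big_periodic_shift _ i eta_per).
by apply: eq_bigr => j _; rewrite mxE addnC.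
Qed.

Lemma period_row_neq0 i : row i V != 0.
Proof.
apply/negP => /eqP/rowP V0; have := sum_period_row i.
rewrite big1 => [/eqP|j _]; first by rewrite eq_sym oppr_eq0 oner_eq0.
by have := V0 j; rewrite !mxE.
Qed.

Lemma period_matrix_unit : V \in unitmx.
Proof. by have [] := eigenspace_lines unit_conj_inj period_row_eigen period_row_neq0. Qed.

Lemma eigenspace_period_row i : (l i :=: row i V)%MS.
Proof. by have [_] := eigenspace_lines unit_conj_inj period_row_eigen period_row_neq0; apply. Qed.

Lemma unit_conj_eigenvalue i : eigenvalue (operator R A) (x i).
Proof.
apply/eigenvalueP; exists (row i V); [exact: period_row_eigen|exact: period_row_neq0].
Qed.

Lemma char_poly_unit_matrix : char_poly (operator R A) = \prod_(i < n) ('X - (x i)%:P).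
Proof. exact: char_poly_eigen unit_conj_inj unit_conj_eigenvalue. Qed.

Lemma unit_matrix_hyperbolic : hyperbolic R A.
Proof.
split.
(* The determinant is the product of the [u i], read off from the constant coefficients. *)
- rewrite unitmxE; suff -> : \det A = 1 by rewrite unitr1.
  apply: (@intr_inj R); rewrite -det_map_mx -/(operator R A) rmorph1.
  have := congr1 (fun q : {poly R} => q`_0) char_poly_unit_matrix.
  rewrite /= char_poly_det -horner_coef0 horner_prod.
  under eq_bigr do rewrite !hornerE -mulN1r.
  rewrite big_split prodr_const card_ord /= prod_u.
  by apply: mulfI; rewrite signr_eq0.
- move=> z; rewrite eigenvalue_root_char.
  have -> : map_mx intr A = map_mx (real_complex R) (operator R A) :> 'M[R[i]]_n.
    by apply/matrixP => a b; rewrite !mxE rmorph_int.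
  rewrite -map_char_poly char_poly_unit_matrix rmorph_prod /root horner_prod.
  rewrite prodf_seq_eq0 => /hasP[i _ /=]; rewrite rmorphB /= map_polyX map_polyC hornerXsubC.
  by rewrite subr_eq0 => /eqP ->; apply/complex_realP; exists (x i).
- apply: (irreducible_conjugates (ltnW n1) unit_conj_inj).
    rewrite -char_poly_unit_matrix map_char_poly; congr char_poly.
    by apply/matrixP => a b; rewrite !mxE rmorph_int.
  by move=> f i j; apply: u_root.
Qed.

Lemma unit_matrix_eigenlines : eigenlines A l.
Proof. by exists x; split; [exact: unit_conj_inj|move=> i; split=> //; apply: unit_conj_eigenvalue]. Qed.

Lemma shift_permutes_eigenlines : permutes_lines l G (shift_perm n).
Proof.
move=> i; apply: (eqmx_trans (eqmxMr _ (eigenspace_period_row i))).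
apply/eqmx_sym/(eqmx_trans (eigenspace_period_row _)).
suff -> : row (shift_perm n i) V = row i V *m operator R G by [].
rewrite /operator map_perm_mx -col_permE; apply/rowP => j; rewrite !mxE !permE /=.
have per_mul q a : eta (q * n + a)%N = eta a.
  by elim: q => // q IHq; rewrite mulSn -addnA addnC eta_per.
have per_mod a b : eta (a %% n + b)%N = eta (a + b)%N.
  by rewrite [in RHS](divn_eq a n) -addnA per_mul.
by rewrite per_mod [in RHS]addnC per_mod addSnnS addnC.
Qed.

Lemma shift_symmetry : symmetry l G.
Proof. by apply: (permutes_lines_symmetry _ shift_permutes_eigenlines); rewrite unitmx_perm. Qed.

Lemma shift_proper_palindromic : proper_palindromic l G.
Proof.
pose i0 : 'I_n := Ordinal (ltnW n1).
split.
  split; first exact: shift_symmetry.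
  exists (shift_perm n); first exact: shift_permutes_eigenlines.
  apply/negP => /eqP/permP/(_ i0)/(congr1 val).
  by rewrite permE perm1 /= modn_small.
pose e : 'rV[R]_n := const_mx 1.
(* Each column of [V] sums to the trace -1, so all coordinates of [e] in the eigenbasis are -1 and
   [e] lies off every hyperplane. *)
have eV : e *m V = - e.
  apply/rowP => j; rewrite !mxE.
  under eq_bigr do rewrite !mxE mul1r.
  by rewrite (big_periodic_shift _ j eta_per).
have eV' : e *m invmx V = - e.
  by apply: (can_inj (mulmxK period_matrix_unit)); rewrite mulmxKV ?period_matrix_unit // mulNmx eV opprK.
have [||C coneC [t sailC]] := sail_meets_line period_matrix_unit eigenspace_period_row i0 (e := e).
- by exists (const_mx 1) => //; rewrite /e; apply/rowP => j; rewrite !mxE.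
- move=> i; rewrite (hyperplane_coord period_matrix_unit eigenspace_period_row) eV' !mxE.
  by rewrite oppr_eq0 oner_eq0.
exists C => //; exists (t *: e) => //.
rewrite -scalemxAl; congr (_ *: _).
by rewrite /operator map_perm_mx -col_permE; apply/rowP => j; rewrite !mxE.
Qed.

Lemma shift_cyclic_symmetry : cyclic_symmetry l G.
Proof.
split; first exact: shift_symmetry.
by exists (shift_perm n); [exact: shift_permutes_eigenlines|exact: shift_perm_porbit].
Qed.

End FromUnit.

Theorem theorem1 (R : realType) (n : nat) (hn : (1 < n)%N) :
  exists (A : 'M[int]_n) (l : 'I_n -> 'M[R]_n),
    hyperbolic R A /\ eigenlines A l /\
    exists G : 'M[int]_n, proper_palindromic l G /\ cyclic_symmetry l G.
Proof.
have [A [u [eta [per [pu se] Aeq [u_inj u_root]]]]] := real_cyclic_unit_exists R hn.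
have u_per j : u (j + n)%N = u j by have [] := per j.
have eta_per j : eta (j + n)%N = eta j by have [] := per j.
exists A, (fun i => eigenspace (operator R A) (u i)).
split; first exact: (unit_matrix_hyperbolic (u := u) (eta := eta)).
split; first exact: (unit_matrix_eigenlines (eta := eta)).
exists (perm_mx (shift_perm n)^-1); split.
  exact: (shift_proper_palindromic (eta := eta)).
exact: (shift_cyclic_symmetry (eta := eta)).
Qed.
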